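(* Every one-dimensional deterministic Hunt process $(X^x)_{x\in\mathbb{R}}$ is a semimartingale, i.e. $X^x$ is a semimartingale for every $x\in\mathbb{R}$.
   Context: A deterministic Markov process on $\mathbb{R}$ is a family $(X^x)_{x\in\mathbb{R}}$ of functions $t\mapsto X_t^x\in\mathbb{R}$, $t\in[0,\infty)$, regarded as stochastic processes not depending on $\omega$ on a filtered measurable space, with $X_0^x=x$ and satisfying time homogeneity: whenever $X_s^x=X_t^y$ for some $s,t\ge0$ and $x,y\in\mathbb{R}$, then $X_{s+h}^x=X_{t+h}^y$ for every $h\ge 0$. It is called a (deterministic) Hunt process if it is càdlàg and quasi-left continuous for every starting point, which for deterministic Markov processes means that all paths $t\mapsto X_t^x$ are continuous. *)

(* Defs.v *)
From mathcomp Require Import all_boot all_order all_algebra.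
From mathcomp Require Import all_classical all_reals all_analysis.

Set Implicit Arguments.
Unset Strict Implicit.
Unset Printing Implicit Defensive.

Import Order.TTheory GRing.Theory Num.Theory.
Import numFieldNormedType.Exports.

Local Open Scope classical_set_scope.
Local Open Scope ring_scope.

(** Time is [0, +oo[.  Filtrations, processes and paths are indexed by the
    whole of [R], but all the predicates below look at nonnegative times only. *)

Section paths.
Context {R : realType}.
Implicit Type f : R -> R.

Definition cadlag f : Prop :=
  (forall t, 0 <= t -> f @ t^'+ --> f t) /\
  (forall t, 0 < t -> exists l : R, f @ t^'- --> l).

Definition finite_variation f : Prop :=
  forall t, 0 <= t -> bounded_variation 0 t f.

End paths.

Section processes.
Context {R : realType} {d : measure_display} {Omega : measurableType d}.
Variables (P : probability Omega R) (F : R -> set (set Omega)).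
Implicit Types (Y M A : R -> Omega -> R) (T : Omega -> \bar R).

(** Neither right-continuity nor completeness of the filtration is required. *)
Record filtration : Prop := {
  filtration_sigma_algebra :
    forall t, 0 <= t -> sigma_algebra [set: Omega] (F t);
  filtration_measurable :
    forall t, 0 <= t -> F t `<=` measurable;
  filtration_nondecreasing :
    forall s t, 0 <= s -> s <= t -> F s `<=` F t }.

Definition measurable_at (t : R) (f : Omega -> R) : Prop :=
  forall B : set R, measurable B -> F t (f @^-1` B).

Definition adapted Y : Prop := forall t, 0 <= t -> measurable_at t (Y t).

Definition cadlag_process Y : Prop := forall w, cadlag (Y ^~ w).

Definition stopping_time T : Prop :=
  (forall w, (0 <= T w)%E) /\
  (forall t, 0 <= t -> F t [set w | (T w <= t%:E)%E]).

(** [Y_T]; meaningful where [T] is finite, since [fine +oo = 0]. *)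
Definition at_time Y T : Omega -> R := fun w => Y (fine (T w)) w.

Definition stopped Y T : R -> Omega -> R :=
  fun t => at_time Y (fun w => Order.min t%:E (T w)).

(** The last field says [E[M_t | F_s] = M_s] almost surely, by the defining
    property of conditional expectation. *)
Record martingale M : Prop := {
  martingale_adapted : adapted M;
  martingale_cadlag : cadlag_process M;
  martingale_integrable :
    forall t, 0 <= t -> P.-integrable [set: Omega] (EFin \o M t);
  martingale_condexp :
    forall s t, 0 <= s -> s <= t -> forall E, F s E ->
      (\int[P]_(w in E) (M t w)%:E = \int[P]_(w in E) (M s w)%:E)%E }.

Definition local_martingale M : Prop :=
  [/\ adapted M, cadlag_process M &
    exists tau : nat -> Omega -> \bar R,
      [/\ forall n, stopping_time (tau n),
          forall n w, (tau n w <= tau n.+1 w)%E,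
          {ae P, forall w, tau n w @[n --> \oo] --> +oo%E} &
          forall n, martingale (stopped M (tau n))]].

Definition finite_variation_process A : Prop :=
  [/\ adapted A, cadlag_process A & forall w, finite_variation (A ^~ w)].

Definition semimartingale Y : Prop :=
  measurable_at 0 (Y 0) /\
  exists M A : R -> Omega -> R,
    [/\ local_martingale M, forall w, M 0 w = 0,
        finite_variation_process A, forall w, A 0 w = 0 &
        forall t w, 0 <= t -> Y t w = Y 0 w + M t w + A t w].

Definition quasi_left_continuous Y : Prop :=
  forall (S : nat -> Omega -> \bar R) T,
    (forall n, stopping_time (S n)) -> stopping_time T ->
    (forall n w, (S n w <= S n.+1 w)%E) ->
    (forall w, S n w @[n --> \oo] --> T w) ->
    {ae P, forall w, (T w < +oo)%E ->
      at_time Y (S n) w @[n --> \oo] --> at_time Y T w}.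

End processes.

Definition deterministic_process {R : realType} {d : measure_display}
    (Omega : measurableType d) (f : R -> R) : R -> Omega -> R :=
  fun t _ => f t.
Arguments deterministic_process {R d} Omega f.

Section deterministic.
Context {R : realType}.

(** [X x t] is the position at time [t] of the path started at [x]. *)
Record deterministic_markov (X : R -> R -> R) : Prop := {
  deterministic_markov_start : forall x, X x 0 = x;
  deterministic_markov_homogeneous : forall x y s t, 0 <= s -> 0 <= t ->
    X x s = X y t -> forall h, 0 <= h -> X x (s + h) = X y (t + h) }.

(** As the constant times are stopping times and [X] does not depend on [w],
    the last two fields together amount to continuity of all the paths
    [X x] on [0, +oo[. *)
Record deterministic_hunt {d : measure_display} {Omega : measurableType d}
    (P : probability Omega R) (F : R -> set (set Omega)) (X : R -> R -> R) :
    Prop := {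
  deterministic_hunt_markov : deterministic_markov X;
  deterministic_hunt_cadlag :
    forall x, cadlag_process (deterministic_process Omega (X x));
  deterministic_hunt_quasi_left_continuous :
    forall x, quasi_left_continuous P F (deterministic_process Omega (X x)) }.

End deterministic.

(* Main.v *)
Require Import Defs.
From mathcomp Require Import all_boot all_order all_algebra.
From mathcomp Require Import all_classical all_reals all_analysis.
From mathcomp Require Import lra.

(** A point of a continuous path lying strictly above two others, one before
    and one after it, forces an interior maximum [m]; by the intermediate value
    theorem the path takes equal values at times [u <= m <= w] with [w - u]
    arbitrarily small.  By homogeneity it is then periodic after [m] with
    arbitrarily small periods, hence constant after [m] by continuity at [m],
    which is absurd.  So the paths are monotone, and a monotone path is its own
    finite variation part. *)

Set Implicit Arguments.
Unset Strict Implicit.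
Unset Printing Implicit Defensive.

Import Order.TTheory GRing.Theory Num.Theory.
Import numFieldNormedType.Exports.
Local Open Scope classical_set_scope.
Local Open Scope ring_scope.

(** * Monotonicity of continuous time-homogeneous paths *)

Section homogeneous_paths.
Context {R : realType}.
Implicit Types f : R -> R.

(** Homogeneity of a Markov family, read along one and the same path. *)
Definition time_homogeneous f : Prop :=
  forall s t, 0 <= s -> 0 <= t -> f s = f t ->
  forall h, 0 <= h -> f (s + h) = f (t + h).

(** The larger of [f a] and [f b] lies between the other end value and [f m], so the intermediate
    value theorem attains it on the opposite side of [m]. *)
Lemma equal_values_around_max f (a m b : R) :
  a < m -> m < b -> {within `[a, b], continuous f} ->
  (forall t, t \in `[a, b] -> f t <= f m) ->
  exists u w, [/\ a <= u, u <= m, m <= w, w <= b & u < w /\ f u = f w].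
Proof.
move=> am mb fc fm.
have fcl : {within `[a, m], continuous f}.
  by apply: continuous_subspaceW fc; apply: subset_itvl; rewrite bnd_simp ltW.
have fcr : {within `[m, b], continuous f}.
  by apply: continuous_subspaceW fc; apply: subset_itvr; rewrite bnd_simp ltW.
have fam : f a <= f m by apply: fm; rewrite in_itv /= lexx ltW// (lt_trans am).
have fbm : f b <= f m.
  by apply: fm; rewrite in_itv /= lexx andbT ltW// (lt_trans am).
have [fab|fba] := leP (f a) (f b).
- have [|u] := @IVT _ f a m (f b) (ltW am) fcl.
    by rewrite (min_idPl fam) (max_idPr fam) fab fbm.
  rewrite in_itv /= => /andP[au um] fub.
  by exists u, b; split; rewrite ?(ltW mb) ?fub ?(le_lt_trans um).
- have [|w] := @IVT _ f m b (f a) (ltW mb) fcr.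
    by rewrite (min_idPr fbm) (max_idPl fbm) fam (ltW fba).
  rewrite in_itv /= => /andP[mw wb] fwa.
  by exists a, w; split; rewrite ?(ltW am) ?fwa ?(lt_le_trans am).
Qed.

(** For [s >= u], homogeneity at the times [u] and [w] with delay [s - u] reads
    [f s = f (s + (w - u))]; iterate. *)
Lemma time_homogeneous_periodic f (u w : R) :
  time_homogeneous f -> 0 <= u -> u <= w -> f u = f w ->
  forall t n, u <= t -> f (t + (w - u) *+ n) = f t.
Proof.
move=> fh u0 uw fuw t n ut; elim: n => [|n IHn]; first by rewrite mulr0n addr0.
rewrite -{}IHn; set s := t + (w - u) *+ n.
have us : u <= s.
  by rewrite /s (le_trans ut)// lerDl mulrn_wge0// subr_ge0.
have := fh u w u0 (le_trans u0 uw) fuw (s - u).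
rewrite subr_ge0 => /(_ us).
rewrite [u + _]addrC subrK => ->; congr f.
by rewrite mulrSr addrA -/s addrC -addrA [- u + _]addrC.
Qed.

(** One small period [q] is enough: stepping back from [c] by multiples of [q] ends so close to the
    maximum point [m] that [f] exceeds [f c] there, against periodicity. *)
Lemma time_homogeneous_no_peak f (a b c : R) :
  time_homogeneous f -> {within `[a, c], continuous f} ->
  0 <= a -> a < b -> b < c -> f a < f b -> f b <= f c.
Proof.
move=> fh fc a0 ab bc fab; rewrite leNgt; apply/negP => fcb.
have ac := lt_trans ab bc.
have [m] := EVT_max (ltW ac) fc; rewrite in_itv /= => /andP[am mc] fm.
have fbm : f b <= f m by apply: fm; rewrite in_itv /= !ltW.
have {}am : a < m.
  by rewrite lt_neqAle am andbT; apply: contraTneq fab => ->; rewrite -leNgt.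
have {}mc : m < c.
  by rewrite lt_neqAle mc andbT; apply: contraTneq fcb => <-; rewrite -leNgt.
have [fci _ _] := (continuous_within_itvP f ac).1 fc.
have /cvgrPdist_lt/(_ (f m - f c)) : f @ m --> f m.
  by apply: fci; rewrite in_itv /= am.
rewrite subr_gt0 (lt_le_trans fcb fbm) => /(_ isT) [r /= r0 fr].
(* The period will be at most [2 * e], hence less than the radius [r] on which [f] stays above
   [f c]; the other two bounds keep the window inside [[a, c]]. *)
pose e := Num.min (r / 3) (Num.min (m - a) (c - m)).
have e0 : 0 < e by rewrite !lt_min !subr_gt0 am mc divr_gt0.
have er : e <= r / 3 by rewrite !ge_min lexx.
have ea : e <= m - a by rewrite !ge_min lexx !orbT.
have ec : e <= c - m by rewrite !ge_min lexx !orbT.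
have sub : `[m - e, m + e] `<=` `[a, c].
  by apply: subset_itv; rewrite bnd_simp; lra.
have [|||t|u [w [eu um mw we [uw fuw]]]] :=
    @equal_values_around_max f (m - e) m (m + e).
- by rewrite ltrBlDr ltrDl.
- by rewrite ltrDl.
- exact: continuous_subspaceW fc.
- by move=> /sub; exact: fm.
have [q qE] : {q | q = w - u} by exists (w - u).
have q0 : 0 < q by rewrite qE subr_gt0.
(* The number of whole periods between [m] and [c], so that [c - q *+ n] lies in [[m, m + q[]. *)
pose n := Num.truncn ((c - m) / q).
have cmq : 0 <= (c - m) / q by apply: divr_ge0; rewrite ?subr_ge0 ltW.
have /andP[nl nr] := truncn_itv cmq.
have {}nl : q *+ n <= c - m by rewrite -mulr_natl -ler_pdivlMr.
have {}nr : c - m < q *+ n + q by rewrite -mulrSr -mulr_natl -ltr_pdivrMr.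
have u0 : 0 <= u by lra.
have fcE : f c = f (c - q *+ n).
  apply: etrans (time_homogeneous_periodic fh u0 (ltW uw) fuw n _); last by lra.
  by rewrite -qE subrK.
have /= : `|f m - f (c - q *+ n)| < f m - f c.
  by apply: fr; rewrite /= ltr_norml; lra.
by rewrite -fcE ltNge ler_norm.
Qed.

Lemma time_homogeneousN f : time_homogeneous f -> time_homogeneous (\- f).
Proof. by move=> fh s t s0 t0 /oppr_inj fst h h0 /=; rewrite (fh s t). Qed.

(** Comparing [f 0] with [f t] decides the direction of monotonicity on [[0, t]]; the decreasing
    case passes to [- f]. *)
Lemma time_homogeneous_finite_variation f :
  time_homogeneous f -> (forall t, 0 < t -> {within `[0, t], continuous f}) ->
  finite_variation f.
Proof.
have key g t : time_homogeneous g -> 0 < t ->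
    {within `[0, t], continuous g} -> g 0 <= g t ->
    {in `[0, t] &, {homo g : x y / x <= y}}.
  move=> gh t0 gc g0t x y; rewrite !in_itv /= => /andP[x0 xt] /andP[y0 yt].
  rewrite le_eqVlt => /predU1P[->//|xy]; rewrite leNgt; apply/negP => gyx.
  (* A descent from [x] to [y] allows neither a rise before it (a peak at [x]) nor one after it (a
     valley at [y]), so [g t < g 0]. *)
  have gx0 : g x <= g 0.
    move: x0; rewrite le_eqVlt => /predU1P[<-//|x0]; rewrite leNgt.
    apply/negP => g0x; suff : g x <= g y by rewrite leNgt gyx.
    apply: (time_homogeneous_no_peak gh _ (lexx 0) x0 xy g0x).
    by apply: continuous_subspaceW gc; apply: subset_itvl; rewrite bnd_simp.
  have gty : g t <= g y.
    move: yt; rewrite le_eqVlt => /predU1P[->//|yt]; rewrite leNgt.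
    apply/negP => gyt; suff : - g y <= - g t by rewrite lerN2 leNgt gyt.
    apply: (time_homogeneous_no_peak (time_homogeneousN gh) _ x0 xy yt);
      last by rewrite ltrN2.
    have gxt : {within `[x, t], continuous g}.
      by apply: continuous_subspaceW gc; apply: subset_itvr; rewrite bnd_simp.
    by move=> z; apply: cvgN; exact: gxt.
  by have := lt_le_trans gyx (le_trans gx0 (le_trans g0t gty)); rewrite ltxx.
move=> fh fc t; rewrite le_eqVlt => /predU1P[<-|t0].
  exact: bounded_variationxx.
have [f0t|ft0] := leP (f 0) (f t).
  by apply: nondecreasing_bounded_variation; apply: key => //; exact: fc.
have -> : f = \- (\- f) by apply/funext => z /=; rewrite opprK.
apply: bounded_variationN; apply: nondecreasing_bounded_variation.
apply: key => //; first exact: time_homogeneousN.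
  by move=> z; apply: cvgN; exact: fc.
by rewrite lerN2 ltW.
Qed.

End homogeneous_paths.

(** * Deterministic paths as stochastic processes *)

Section deterministic_processes.
Context {R : realType} {d : measure_display} {Omega : measurableType d}.
Variables (P : probability Omega R) (F : R -> set (set Omega)).
Hypothesis filF : filtration F.

(** Such an event is empty or the whole space. This makes deterministic processes adapted and
    constant times stopping times. *)
Lemma filtration_cst (t : R) (Q : Prop) : 0 <= t -> F t [set _ | Q].
Proof.
move=> t0; have [F0 FC _] := filtration_sigma_algebra filF t0.
have [q|nq] := pselect Q.
  rewrite (_ : [set _ | Q] = [set: Omega] `\` set0); first exact: FC.
  by rewrite setD0; apply/seteqP; split.
by rewrite (_ : [set _ | Q] = set0)//; apply/seteqP; split.
Qed.

Lemma adapted_deterministic (f : R -> R) :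
  adapted F (deterministic_process Omega f).
Proof. by move=> t t0 B _; exact: (filtration_cst (B (f t))). Qed.

Lemma stopping_time_cst (t : \bar R) : (0 <= t)%E -> stopping_time F (cst t).
Proof. by move=> t0; split=> // s; exact: (filtration_cst (t <= s%:E)%E). Qed.

Lemma local_martingale0 : local_martingale P F (fun _ _ => 0).
Proof.
have cadlag0 : cadlag_process (fun (_ : R) (_ : Omega) => 0 : R).
  by move=> w; split=> [t t0|t t0]; [|exists 0]; exact: cvg_cst.
split=> //; first exact: (adapted_deterministic (cst 0)).
exists (fun _ _ => +oo%E); split=> //.
- by move=> n; apply: stopping_time_cst.
- by apply: aeW => w; exact: cvg_cst.
move=> n; split=> //.
- exact: (adapted_deterministic (cst 0)).
- by move=> t t0; exact: integrable0.
Qed.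

Lemma quasi_left_continuous_deterministic (f : R -> R) :
  cadlag f -> quasi_left_continuous P F (deterministic_process Omega f) ->
  forall t, 0 < t -> {within `[0, t], continuous f}.
Proof.
move=> [fr fl] qlc.
have left_cont t : 0 < t -> f @ t^'- --> f t.
  move=> t0; have [l fl_t] := fl t t0; suff -> : f t = l by [].
  (* These are the times [t - t / (n + 1)]: nonnegative, since [u 0 = 0], and increasing to [t] from
     strictly below. *)
  pose u (n : nat) : R := t - t * harmonic n.
  have ult n : u n < t by rewrite ltrBlDr ltrDl mulr_gt0// harmonic_gt0.
  have ucvg : u @ \oo --> t.
    rewrite -[X in _ --> X]subr0 -[X in _ - X](mulr0 t).
    by apply: cvgB; [exact: cvg_cst|apply: cvgMr; exact: cvg_harmonic].
  have u0 n : 0 <= u n.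
    rewrite subr_ge0 -[leRHS]mulr1 ler_pM2l// /harmonic invf_le1//.
    by rewrite ler1n.
  have [n||n w|w|A [mA PA0 H]] := qlc (fun n => cst (u n)%:E) (cst t%:E).
  - by apply: stopping_time_cst; rewrite lee_fin.
  - by apply: stopping_time_cst; rewrite lee_fin ltW.
  - rewrite lee_fin lerB// ler_pM2l// /harmonic lef_pV2 ?posrE//.
    by rewrite ler_nat.
  - by apply: cvg_EFin => //; apply: nearW.
  (* The exceptional set is null while [P] has mass 1, so some [w] escapes it; the path being
     independent of [w], one is enough. *)
  have [w Aw] : exists w, ~ A w.
    apply/existsNP => AT; move: PA0.
    rewrite (_ : A = setT) ?probability_setT => [/eqP|].
      by rewrite onee_eq0.
    by apply/seteqP; split.
  have : (cst t%:E w < +oo)%E ->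
      at_time (deterministic_process Omega f) (cst (u n)%:E) w
        @[n --> \oo] --> at_time (deterministic_process Omega f) (cst t%:E) w.
    by apply: contrapT => nH; apply/Aw/H.
  rewrite /at_time /deterministic_process /= ltry => /(_ isT) fu.
  have := (cvg_at_leftP f t l).1 fl_t u (conj ult ucvg).
  exact: cvg_unique fu.
move=> t t0; apply/continuous_within_itvP => //; split.
- move=> z; rewrite in_itv /= => /andP[z0 zt].
  by apply/left_right_continuousP; split; [exact: left_cont|apply/fr/ltW].
- exact: fr.
- exact: left_cont.
Qed.

End deterministic_processes.

Theorem corollary2p9 (R : realType) (d : measure_display)
    (Omega : measurableType d) (P : probability Omega R)
    (F : R -> set (set Omega)) (X : R -> R -> R) :
  filtration F -> deterministic_hunt P F X ->
  forall x : R, semimartingale P F (deterministic_process Omega (X x)).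
Proof.
move=> filF [[_ Xh] Xcadlag Xqlc] x; split.
  exact: adapted_deterministic.
(* A sample point is needed to extract path regularity from a statement quantified over [w]. *)
have [w0 _] : exists w : Omega, True.
  apply: contrapT => /forallNP noW.
  have := @probability_setT _ _ _ P.
  rewrite (_ : setT = set0) ?measure0 => [/esym/eqP|].
    by rewrite onee_eq0.
  by apply/seteqP; split=> w // _; exact: (noW w).
have Xx_cadlag : cadlag (X x) := Xcadlag x w0.
have Xx_fv : finite_variation (X x).
  apply: time_homogeneous_finite_variation; first exact: Xh.
  exact: quasi_left_continuous_deterministic (Xqlc x).
(* The martingale part vanishes; subtracting the starting point makes the finite variation part
   start at 0. *)
exists (fun _ _ => 0), (deterministic_process Omega (fun t => X x t - X x 0)).
split=> //.
- exact: local_martingale0.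
- split; first exact: adapted_deterministic.
  + move=> w; split=> [t t0|t t0].
      by apply: cvgB; [exact: Xx_cadlag.1|exact: cvg_cst].
    have [l fl] := Xx_cadlag.2 t t0.
    by exists (l - X x 0); apply: cvgB; [|exact: cvg_cst].
  + move=> w t; rewrite le_eqVlt => /predU1P[<-|t0].
      exact: bounded_variationxx.
    apply: (bounded_variationD t0); first exact/Xx_fv/ltW.
    by apply: nondecreasing_bounded_variation => ? ? ? ? ?.
- by move=> w; exact: subrr.
- by move=> t w _; rewrite /deterministic_process; lra.
Qed.
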